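(* In $\mathsf{ZF}$, the following statements are equivalent: (1) $\mathsf{DC}$. (2) If $G=(V_{G},E_{G})$ is an infinite graph, then for every coloring $f:[V_{G}]^{2}\to\{0,1\}$, if all $0$-monochromatic sets are finite, then there is a maximal $0$-monochromatic set. (3) For every infinite graph $G$, if all independent sets of $G$ are finite, then there exists a maximal independent set of $G$.
   Context: $\mathsf{ZF}$ is Zermelo–Fraenkel set theory without the Axiom of Choice. $[V]^{2}$ is the set of $2$-element subsets of $V$. A graph $G=(V_{G},E_{G})$ consists of a set $V_{G}$ of vertices and a set $E_{G}\subseteq[V_{G}]^{2}$ of edges; it is infinite if $V_G$ is infinite. An independent set of $G$ is a set of vertices no two of which are adjacent; a maximal independent set is an independent set that is not a proper subset of any other independent set. For $f:[V_{G}]^{2}\to\{0,1\}$, a set $Y\subseteq V_{G}$ is $0$-monochromatic if $f(e)=0$ for all $e\in[Y]^{2}$; maximal means maximal with respect to inclusion. $\mathsf{DC}$ (Principle of Dependent Choices): if $S$ is a non-empty set and $R$ is a binary relation on $S$ such that $(\forall x\in S)(\exists y\in S)(x\,R\,y)$, then there is a sequence $(x_{n})_{n\in\omega}$ of elements of $S$ with $x_{n}\,R\,x_{n+1}$ for all $n\in\omega$. *)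

(* Defs.v *)
(* A claim "in ZF, phi" is read as "every model of first-order ZF satisfies phi".
   All notions below (finite, natural number, function, ...) are internal to the
   model: they quantify only over its elements, so each is the satisfaction of a
   first-order formula of set theory.  Rocq's own nat, functions and choice
   principles play no role in them; in particular omega may be non-standard. *)

Set Implicit Arguments.
Unset Strict Implicit.

Record set_structure : Type := SetStructure {
  carrier :> Type;
  mem : carrier -> carrier -> Prop
}.

Notation "x ∈ y" := (mem x y) (at level 70, no associativity).

(* Formulas are needed only for the two axiom schemata.  Quantifying there over
   arbitrary Rocq predicates instead would give second-order ZF, whose models
   inherit the axiom of choice from a choice principle in the metatheory.
   Variables are de Bruijn indices. *)
Inductive formula : Type :=
| FMem (i j : nat)
| FEq (i j : nat)
| FBot
| FImp (A B : formula)
| FAnd (A B : formula)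
| FOr (A B : formula)
| FAll (A : formula)
| FEx (A : formula).

Definition scons (T : Type) (x : T) (e : nat -> T) (n : nat) : T :=
  match n with
  | O => x
  | S m => e m
  end.

Fixpoint sat (M : set_structure) (e : nat -> M) (A : formula) : Prop :=
  match A with
  | FMem i j => e i ∈ e j
  | FEq i j => e i = e j
  | FBot => False
  | FImp B C => sat e B -> sat e C
  | FAnd B C => sat e B /\ sat e C
  | FOr B C => sat e B \/ sat e C
  | FAll B => forall x : M, sat (scons x e) B
  | FEx B => exists x : M, sat (scons x e) B
  end.

Definition is_empty (M : set_structure) (x : M) : Prop :=
  forall z, ~ z ∈ x.

Definition subset (M : set_structure) (x y : M) : Prop :=
  forall z, z ∈ x -> z ∈ y.

Definition proper_subset (M : set_structure) (x y : M) : Prop :=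
  subset x y /\ x <> y.

(* p = {x, y} *)
Definition is_pair (M : set_structure) (p x y : M) : Prop :=
  forall z, z ∈ p <-> z = x \/ z = y.

(* s = x ∪ {x} *)
Definition is_succ (M : set_structure) (s x : M) : Prop :=
  forall z, z ∈ s <-> z ∈ x \/ z = x.

Definition inductive (M : set_structure) (I : M) : Prop :=
  (exists o, is_empty o /\ o ∈ I) /\
  (forall x, x ∈ I -> exists s, is_succ s x /\ s ∈ I).

(* The environment e supplies the parameters of the schema instance A; in
   replacement, index 0 is the value and index 1 the argument. *)
Record ZF (M : set_structure) : Prop := {
  ZF_extensionality : forall x y : M, (forall z, z ∈ x <-> z ∈ y) -> x = y;
  ZF_foundation : forall x : M,
    (exists y, y ∈ x) -> exists y, y ∈ x /\ forall z, z ∈ x -> ~ z ∈ y;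
  ZF_pairing : forall x y : M, exists p, is_pair p x y;
  ZF_union : forall x : M,
    exists u, forall z, z ∈ u <-> exists y, y ∈ x /\ z ∈ y;
  ZF_power : forall x : M, exists p, forall z, z ∈ p <-> subset z x;
  ZF_infinity : exists I : M, inductive I;
  ZF_separation : forall (A : formula) (e : nat -> M) (a : M),
    exists b, forall x, x ∈ b <-> x ∈ a /\ sat (scons x e) A;
  ZF_replacement : forall (A : formula) (e : nat -> M) (a : M),
    (forall x y y', x ∈ a ->
       sat (scons y (scons x e)) A -> sat (scons y' (scons x e)) A -> y = y') ->
    exists b, forall y, y ∈ b <-> exists x, x ∈ a /\ sat (scons y (scons x e)) A
}.

(* Kuratowski pair: p = {{x}, {x, y}} *)
Definition is_opair (M : set_structure) (p x y : M) : Prop :=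
  exists a b, is_pair a x x /\ is_pair b x y /\ is_pair p a b.

Definition related (M : set_structure) (R x y : M) : Prop :=
  exists p, is_opair p x y /\ p ∈ R.

Definition relation_between (M : set_structure) (R A B : M) : Prop :=
  forall p, p ∈ R -> exists x y, x ∈ A /\ y ∈ B /\ is_opair p x y.

Definition is_function (M : set_structure) (f A B : M) : Prop :=
  relation_between f A B /\ forall x, x ∈ A -> exists! y, related f x y.

Definition is_bijection (M : set_structure) (f A B : M) : Prop :=
  is_function f A B /\ forall y, y ∈ B -> exists! x, related f x y.

Definition is_natural (M : set_structure) (n : M) : Prop :=
  forall I, inductive I -> n ∈ I.

Definition is_omega (M : set_structure) (w : M) : Prop :=
  forall n, n ∈ w <-> is_natural n.

Definition finite (M : set_structure) (x : M) : Prop :=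
  exists n f, is_natural n /\ is_bijection f n x.

Definition infinite (M : set_structure) (x : M) : Prop := ~ finite x.

(* e ∈ [V]^2 *)
Definition two_subset (M : set_structure) (e V : M) : Prop :=
  exists x y, x ∈ V /\ y ∈ V /\ x <> y /\ is_pair e x y.

(* P = [V]^2 *)
Definition is_two_subsets (M : set_structure) (P V : M) : Prop :=
  forall e, e ∈ P <-> two_subset e V.

Definition is_graph (M : set_structure) (V E : M) : Prop :=
  forall e, e ∈ E -> two_subset e V.

Definition adjacent (M : set_structure) (E x y : M) : Prop :=
  exists e, is_pair e x y /\ e ∈ E.

Definition independent (M : set_structure) (V E Y : M) : Prop :=
  subset Y V /\
  forall x y, x ∈ Y -> y ∈ Y -> x <> y -> ~ adjacent E x y.

(* t = 1 = {0} *)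
Definition is_one (M : set_structure) (t : M) : Prop :=
  exists o, is_empty o /\ is_succ t o.

(* t = {0, 1} *)
Definition is_zero_one (M : set_structure) (t : M) : Prop :=
  exists o i, is_empty o /\ is_one i /\ is_pair t o i.

(* f : [V]^2 -> {0, 1} *)
Definition is_coloring (M : set_structure) (f V : M) : Prop :=
  exists P t, is_two_subsets P V /\ is_zero_one t /\ is_function f P t.

Definition monochromatic0 (M : set_structure) (V f Y : M) : Prop :=
  subset Y V /\
  forall e, two_subset e Y -> exists o, is_empty o /\ related f e o.

Definition maximal (M : set_structure) (P : M -> Prop) (Y : M) : Prop :=
  P Y /\ ~ exists Z, P Z /\ proper_subset Y Z.

Definition DC (M : set_structure) : Prop :=
  forall S R : M,
    (exists x, x ∈ S) ->
    relation_between R S S ->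
    (forall x, x ∈ S -> exists y, y ∈ S /\ related R x y) ->
    exists w s, is_omega w /\ is_function s w S /\
      forall n m x y, n ∈ w -> is_succ m n ->
        related s n x -> related s m y -> related R x y.

Definition coloring_statement (M : set_structure) : Prop :=
  forall V E : M, is_graph V E -> infinite V ->
  forall f : M, is_coloring f V ->
    (forall Y, monochromatic0 V f Y -> finite Y) ->
    exists Y, maximal (monochromatic0 V f) Y.

Definition independent_set_statement (M : set_structure) : Prop :=
  forall V E : M, is_graph V E -> infinite V ->
    (forall Y, independent V E Y -> finite Y) ->
    exists Y, maximal (independent V E) Y.

(* Main.v *)
(** From DC to colorings: if no 0-monochromatic set is maximal, DC gives a strictly
    increasing sequence of 0-monochromatic sets.  Its union is 0-monochromatic,
    hence finite, but a family of subsets of a finite set has a maximal member.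

    From graphs to DC: on the finite [R]-paths in [S], join two paths by an edge
    when neither extends the other, so that independent sets are chains.  An
    infinite chain has paths of unbounded length (it has at most one path of
    each length), and its union is the sequence required by DC.  A finite chain
    has a longest path, which can be prolonged, so it is not maximal. *)

From Stdlib Require Import Classical.
Require Import Defs.

Set Implicit Arguments.
Unset Strict Implicit.

(** * First-order definability *)

(** Definability is taken semantically: some formula has [P] as its truth set. Instances of
    separation can then be stated with ordinary predicates while the formula itself stays hidden. *)
Definition definable (M : set_structure) (P : (nat -> M) -> Prop) : Prop :=
  exists A, forall e, sat e A <-> P e.

Section Definability.

Context {M : set_structure}.
Implicit Types P Q : (nat -> M) -> Prop.

Lemma definable_mem i j : definable (fun e : nat -> M => e i ∈ e j).
Proof. exists (FMem i j); reflexivity. Qed.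

Lemma definable_eq i j : definable (fun e : nat -> M => e i = e j).
Proof. exists (FEq i j); reflexivity. Qed.

Lemma definable_False : definable (fun _ : nat -> M => False).
Proof. exists FBot; reflexivity. Qed.

Lemma definable_imp P Q :
  definable P -> definable Q -> definable (fun e => P e -> Q e).
Proof. intros [A HA] [B HB]; exists (FImp A B); intro e; simpl; rewrite HA, HB; tauto. Qed.

Lemma definable_and P Q :
  definable P -> definable Q -> definable (fun e => P e /\ Q e).
Proof. intros [A HA] [B HB]; exists (FAnd A B); intro e; simpl; rewrite HA, HB; tauto. Qed.

Lemma definable_or P Q :
  definable P -> definable Q -> definable (fun e => P e \/ Q e).
Proof. intros [A HA] [B HB]; exists (FOr A B); intro e; simpl; rewrite HA, HB; tauto. Qed.

(* [scons x e] turns the premise back into [Q e x] by computation and eta. *)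
Lemma definable_forall (Q : (nat -> M) -> M -> Prop) :
  definable (fun e => Q (fun n => e (S n)) (e 0)) ->
  definable (fun e => forall x, Q e x).
Proof.
  intros [A HA]; exists (FAll A); intro e; simpl.
  split; intros H x; apply (HA (scons x e)), H.
Qed.

Lemma definable_exists (Q : (nat -> M) -> M -> Prop) :
  definable (fun e => Q (fun n => e (S n)) (e 0)) ->
  definable (fun e => exists x, Q e x).
Proof.
  intros [A HA]; exists (FEx A); intro e; simpl.
  split; intros [x H]; exists x; apply (HA (scons x e)), H.
Qed.

End Definability.

(** Unfolding leaves only membership, equality, connectives and quantifiers, each handled by one of
    the closure lemmas above. *)
Ltac definability :=
  cbv beta delta [finite infinite is_bijection is_function relation_between
    is_natural inductive related is_opair is_succ is_pair is_one is_empty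
    proper_subset subset monochromatic0 two_subset independent adjacent
    unique not iff];
  repeat (cbv beta; first
    [ apply definable_mem | apply definable_eq | apply definable_False
    | apply definable_and | apply definable_or | apply definable_exists
    | apply definable_imp | apply definable_forall ]).

Section Sets.

Context {M : set_structure} (Z : ZF M).
Implicit Types x y z u v w a b c o p q r s t f n m i j k A B C F I R U V X Y : M.

(** * Sets, pairs and relations *)

Lemma set_ext x y : (forall z, z ∈ x <-> z ∈ y) -> x = y.
Proof. exact (ZF_extensionality Z (x := x) (y := y)). Qed.

(** The parameters are arguments of [P] and not captured by it, since a formula can mention elements
    of the model only through the environment. Three parameters suffice for every instance below. *)
Lemma separation (P : M -> M -> M -> M -> Prop)
    (dP : definable (fun e => P (e 0) (e 1) (e 2) (e 3))) p q r a :
  exists b, forall x, x ∈ b <-> x ∈ a /\ P x p q r.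
Proof.
  destruct dP as [A HA].
  destruct (ZF_separation Z A (scons p (scons q (fun _ => r))) a) as [b Hb].
  exists b; intro x; rewrite Hb.
  apply and_iff_compat_l, (HA (scons x (scons p (scons q (fun _ => r))))).
Qed.

Lemma empty_exists : exists o : M, is_empty o.
Proof. destruct (ZF_infinity Z) as [I [[o [Ho _]] _]]; eauto. Qed.

Lemma empty_unique x y : is_empty x -> is_empty y -> x = y.
Proof. intros Hx Hy; apply set_ext; intro z; split; intro H; [elim (Hx z H)|elim (Hy z H)]. Qed.

Lemma union2_exists A B : exists U, forall z, z ∈ U <-> z ∈ A \/ z ∈ B.
Proof.
  destruct (ZF_pairing Z A B) as [p Hp], (ZF_union Z p) as [U HU].
  exists U; intro z; rewrite HU; split.
  - intros [y [Hy Hz]]; apply Hp in Hy as [-> | ->]; auto.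
  - intros [H | H]; [exists A | exists B]; split; auto; apply Hp; auto.
Qed.

Definition adjoin x' x a : Prop := forall z, z ∈ x' <-> z ∈ x \/ z = a.

Lemma adjoin_exists x a : exists x', adjoin x' x a.
Proof.
  destruct (ZF_pairing Z a a) as [p Hp], (union2_exists x p) as [U HU].
  exists U; intro z; rewrite HU, (Hp z); tauto.
Qed.

Lemma is_pair_inj p x y x' y' : is_pair p x y -> is_pair p x' y' ->
  x = x' /\ y = y' \/ x = y' /\ y = x'.
Proof.
  intros H H'.
  assert (Hx : x ∈ p) by (apply H; auto).
  assert (Hy : y ∈ p) by (apply H; auto).
  assert (Hx' : x' ∈ p) by (apply H'; auto).
  assert (Hy' : y' ∈ p) by (apply H'; auto).
  apply H' in Hx, Hy; apply H in Hx', Hy'.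
  intuition congruence.
Qed.

Lemma is_pair_unique p q x y : is_pair p x y -> is_pair q x y -> p = q.
Proof. intros H H'; apply set_ext; intro z; rewrite (H z), (H' z); tauto. Qed.

Lemma is_opair_inj p x y x' y' :
  is_opair p x y -> is_opair p x' y' -> x = x' /\ y = y'.
Proof.
  intros [a [b [Ha [Hb Hp]]]] [a' [b' [Ha' [Hb' Hp']]]].
  destruct (is_pair_inj Hp Hp') as [[<- <-] | [<- <-]].
  - destruct (is_pair_inj Ha Ha'), (is_pair_inj Hb Hb'); intuition congruence.
  - destruct (is_pair_inj Ha Hb'), (is_pair_inj Hb Ha'); intuition congruence.
Qed.

Lemma is_opair_unique p q x y : is_opair p x y -> is_opair q x y -> p = q.
Proof.
  intros [a [b [Ha [Hb Hp]]]] [a' [b' [Ha' [Hb' Hq]]]].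
  rewrite <- (is_pair_unique Ha Ha'), <- (is_pair_unique Hb Hb') in Hq.
  exact (is_pair_unique Hp Hq).
Qed.

Lemma opair_exists x y : exists p, is_opair p x y.
Proof.
  destruct (ZF_pairing Z x x) as [a Ha], (ZF_pairing Z x y) as [b Hb].
  destruct (ZF_pairing Z a b) as [p Hp]; exists p, a, b; auto.
Qed.

Lemma related_opair R p x y : is_opair p x y -> (related R x y <-> p ∈ R).
Proof.
  intro Hp; split.
  - intros [q [Hq HR]]; rewrite (is_opair_unique Hp Hq); exact HR.
  - intro HR; exists p; auto.
Qed.

Lemma related_subset s t x y : subset s t -> related s x y -> related t x y.
Proof. intros H [p [Hp Hs]]; exists p; auto. Qed.

Lemma product_exists A B :
  exists P, forall p, p ∈ P <-> exists x y, x ∈ A /\ y ∈ B /\ is_opair p x y.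
Proof.
  destruct (union2_exists A B) as [U HU].
  destruct (ZF_power Z U) as [P1 H1], (ZF_power Z P1) as [P2 H2].
  destruct (@separation (fun p A B _ => exists x y, x ∈ A /\ y ∈ B /\ is_opair p x y)
    ltac:(definability) A B A P2) as [P HP].
  exists P; intro p; rewrite HP; split; [tauto|].
  intros [x [y [Hx [Hy Hp]]]]; split; [|eauto].
  destruct Hp as [a [b [Ha [Hb Hp]]]].
  (* Both components [{x}] and [{x, y}] of the pair are subsets of [U], so they are elements of
     [P1], and the pair is an element of [P2]. *)
  apply H2; intros c Hc; apply H1; intros z Hz; apply HU.
  apply Hp in Hc as [-> | ->]; [apply Ha in Hz|apply Hb in Hz];
    destruct Hz as [-> | ->]; auto.
Qed.

Lemma relation_comprehension (P : M -> M -> M -> Prop)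
    (dP : definable (fun e =>
       exists x y, is_opair (e 0) x y /\ P x y (e 1))) p A B :
  exists R, relation_between R A B /\
    forall x y, related R x y <-> x ∈ A /\ y ∈ B /\ P x y p.
Proof.
  destruct (product_exists A B) as [C HC].
  destruct (@separation (fun c p _ _ => exists x y, is_opair c x y /\ P x y p)
    dP p p p C) as [R HR].
  exists R; split.
  - intros c Hc; apply HC, HR, Hc.
  - intros x y; split.
    + intros [c [Hc HcR]]; apply HR in HcR as [HcC [x' [y' [Hc' HP]]]].
      apply HC in HcC as [x'' [y'' [Hx [Hy Hc'']]]].
      destruct (is_opair_inj Hc Hc') as [<- <-].
      destruct (is_opair_inj Hc Hc'') as [<- <-]; auto.
    + intros [Hx [Hy HP]]; destruct (opair_exists x y) as [c Hc].
      exists c; split; [exact Hc|].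
      apply HR; split; [apply HC|]; eauto.
Qed.

(** * Functions inside the model *)

Lemma function_dom f A B x y :
  is_function f A B -> related f x y -> x ∈ A /\ y ∈ B.
Proof.
  intros [Hf _] [p [Hp Hpf]]; destruct (Hf p Hpf) as [x' [y' [Hx [Hy Hp']]]].
  destruct (is_opair_inj Hp Hp') as [<- <-]; auto.
Qed.

Lemma function_unique f A B x y y' :
  is_function f A B -> related f x y -> related f x y' -> y = y'.
Proof.
  intros Hf Hy Hy'; destruct (function_dom Hf Hy) as [Hx _].
  destruct (proj2 Hf x Hx) as [v [_ Hv]].
  rewrite <- (Hv y Hy); exact (Hv y' Hy').
Qed.

Lemma function_value f A B x :
  is_function f A B -> x ∈ A -> exists y, related f x y.
Proof. intros [_ H] Hx; destruct (H x Hx) as [y [Hy _]]; eauto. Qed.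

Lemma function_subset_eq s t A B :
  is_function s A B -> is_function t A B -> subset s t -> s = t.
Proof.
  intros Hs Ht Hst; apply set_ext; intro p; split; [apply Hst|]; intro Hp.
  destruct (proj1 Ht p Hp) as [x [y [Hx [_ Hpxy]]]].
  destruct (function_value Hs Hx) as [y' Hy'].
  assert (y' = y) as ->.
  { apply (function_unique (x := x) Ht); [exact (related_subset Hst Hy')|].
    apply (related_opair t Hpxy), Hp. }
  apply (related_opair s Hpxy), Hy'.
Qed.

(** The codomain may grow from [B] to [B']: a bijection onto a finite set gains the new value [b],
    whereas prolonging a path keeps its codomain. *)
Lemma function_adjoin f A B A' B' a b p f' :
  is_function f A B -> ~ a ∈ A -> adjoin A' A a -> subset B B' -> b ∈ B' ->
  is_opair p a b -> adjoin f' f p ->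
  is_function f' A' B' /\
  forall x y, related f' x y <-> related f x y \/ x = a /\ y = b.
Proof.
  intros Hf Ha HA' HB Hb Hp Hf'.
  assert (Hrel : forall x y, related f' x y <-> related f x y \/ x = a /\ y = b).
  { intros x y; destruct (opair_exists x y) as [q Hq].
    rewrite (related_opair f' Hq), (related_opair f Hq), (Hf' q).
    apply or_iff_compat_l; split.
    - intros ->; exact (is_opair_inj Hq Hp).
    - intros [-> ->]; exact (is_opair_unique Hq Hp). }
  split; [split|exact Hrel].
  - intros q Hq; apply Hf' in Hq as [Hq | ->].
    + destruct (proj1 Hf q Hq) as [x [y [Hx [Hy Hxy]]]].
      exists x, y; repeat split; auto; apply HA'; auto.
    + exists a, b; repeat split; auto; apply HA'; auto.
  - intros x Hx; apply HA' in Hx as [Hx | ->].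
    + destruct (function_value Hf Hx) as [y Hy].
      exists y; split; [apply Hrel; auto|].
      intros y' Hy'; apply Hrel in Hy' as [Hy' | [-> _]]; [|contradiction].
      exact (function_unique Hf Hy Hy').
    + exists b; split; [apply Hrel; auto|].
      intros y' Hy'; apply Hrel in Hy' as [Hy' | [_ ->]]; [|reflexivity].
      elim Ha; exact (proj1 (function_dom Hf Hy')).
Qed.

(** * Foundation and natural numbers *)

Lemma mem_irrefl x : ~ x ∈ x.
Proof.
  intro Hx; destruct (ZF_pairing Z x x) as [p Hp].
  destruct (ZF_foundation Z (x := p)) as [y [Hy Hmin]].
  - exists x; apply Hp; auto.
  - apply Hp in Hy as [-> | ->]; apply (Hmin x); auto; apply Hp; auto.
Qed.

Lemma succ_exists n : exists m, is_succ m n.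
Proof. exact (adjoin_exists n n). Qed.

Lemma succ_unique k m n : is_succ m n -> is_succ k n -> m = k.
Proof. intros Hm Hk; apply set_ext; intro z; rewrite (Hm z), (Hk z); tauto. Qed.

Lemma zero_natural o : is_empty o -> is_natural o.
Proof.
  intros Ho I [[o' [Ho' HI]] _]; rewrite (empty_unique Ho Ho'); exact HI.
Qed.

Lemma succ_natural m n : is_natural n -> is_succ m n -> is_natural m.
Proof.
  intros Hn Hm I HI; destruct (proj2 HI n (Hn I HI)) as [m' [Hm' Hm'I]].
  rewrite (succ_unique Hm Hm'); exact Hm'I.
Qed.

Lemma omega_exists : exists w, is_omega w.
Proof.
  destruct (ZF_infinity Z) as [I HI].
  destruct (@separation (fun n _ _ _ => is_natural n) ltac:(definability) I I I I)
    as [w Hw].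
  exists w; intro n; rewrite Hw; split; [tauto|].
  intro Hn; split; [exact (Hn I HI) | exact Hn].
Qed.

(** The members of omega that satisfy [P] form an inductive set, and a natural number lies in every
    inductive set. Definability of [P] is what makes this collection a set of the model. *)
Lemma natural_ind (P : M -> M -> M -> M -> Prop)
    (dP : definable (fun e => P (e 0) (e 1) (e 2) (e 3))) p q r :
  (forall o, is_empty o -> P o p q r) ->
  (forall n m, is_natural n -> is_succ m n -> P n p q r -> P m p q r) ->
  forall n, is_natural n -> P n p q r.
Proof.
  intros H0 HS; destruct omega_exists as [w Hw].
  destruct (@separation P dP p q r w) as [I HI].
  assert (Hind : inductive I).
  { split.
    - destruct empty_exists as [o Ho]; exists o; split; [exact Ho|].
      apply HI; split; [apply Hw, zero_natural|]; auto.
    - intros n Hn; apply HI in Hn as [Hn HPn]; apply Hw in Hn.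
      destruct (succ_exists n) as [m Hm]; exists m; split; [exact Hm|].
      apply HI; split; [apply Hw, (succ_natural Hn Hm)|eauto]. }
  intros n Hn; apply (HI n), Hn, Hind.
Qed.

Lemma mem_natural n : is_natural n -> forall m, m ∈ n -> is_natural m.
Proof.
  intro Hn.
  apply (@natural_ind (fun n _ _ _ => forall m, m ∈ n -> is_natural m)
    ltac:(definability) n n n); [| |exact Hn].
  - intros o Ho m Hm; elim (Ho m Hm).
  - intros k k' Hk Hk' IH m Hm; apply Hk' in Hm as [Hm | ->]; auto.
Qed.

Lemma natural_transitive n :
  is_natural n -> forall m k, m ∈ n -> k ∈ m -> k ∈ n.
Proof.
  intro Hn.
  apply (@natural_ind (fun n _ _ _ => forall m k, m ∈ n -> k ∈ m -> k ∈ n)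
    ltac:(definability) n n n); [| |exact Hn].
  - intros o Ho m k Hm; elim (Ho m Hm).
  - intros i i' Hi Hi' IH m k Hm Hk; apply Hi'; apply Hi' in Hm as [Hm | ->]; eauto.
Qed.

Lemma zero_or_mem n o : is_natural n -> is_empty o -> o = n \/ o ∈ n.
Proof.
  intros Hn Ho.
  apply (@natural_ind (fun n o _ _ => o = n \/ o ∈ n)
    ltac:(definability) o o o); [| |exact Hn].
  - intros o' Ho'; left; exact (empty_unique Ho Ho').
  - intros k k' _ Hk' [-> | IH]; right; apply Hk'; auto.
Qed.

Lemma succ_mem_or_eq n k m : is_natural n -> k ∈ n -> is_succ m k -> m = n \/ m ∈ n.
Proof.
  intros Hn Hk Hm; revert Hk.
  apply (@natural_ind (fun n k m _ => k ∈ n -> m = n \/ m ∈ n)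
    ltac:(definability) k m m); [| |exact Hn].
  - intros o Ho Hk; elim (Ho k Hk).
  - intros i i' Hi Hi' IH Hk; apply Hi' in Hk as [Hk | ->].
    + right; apply Hi'; destruct (IH Hk); auto.
    + left; exact (succ_unique Hm Hi').
Qed.

(** Induction on [n] with [m] fixed: [zero_or_mem] is the base case, and [succ_mem_or_eq] settles
    the inductive case in which the predecessor lies in [m]. *)
Lemma natural_trichotomy m n :
  is_natural m -> is_natural n -> m ∈ n \/ m = n \/ n ∈ m.
Proof.
  intros Hm Hn.
  apply (@natural_ind (fun n m _ _ => m ∈ n \/ m = n \/ n ∈ m)
    ltac:(definability) m m m); [| |exact Hn].
  - intros o Ho; destruct (zero_or_mem Hm Ho); auto.
  - intros i i' Hi Hi' [H | [-> | H]].
    + left; apply Hi'; auto.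
    + left; apply Hi'; auto.
    + destruct (succ_mem_or_eq Hm H Hi'); auto.
Qed.

Lemma mem_succ_subset n m k :
  is_natural n -> is_succ m n -> k ∈ m -> subset k n.
Proof.
  intros Hn Hm Hk z Hz; apply Hm in Hk as [Hk | ->]; [|exact Hz].
  exact (natural_transitive Hn Hk Hz).
Qed.

(** * Finite sets *)

Lemma finite_empty o : is_empty o -> finite o.
Proof.
  (* The empty set serves both as the number $0$ and as the bijection. *)
  intro Ho; exists o, o; split; [exact (zero_natural Ho)|].
  repeat split; intros z Hz; elim (Ho z Hz).
Qed.

Lemma finite_adjoin x a x' : finite x -> adjoin x' x a -> finite x'.
Proof.
  intros Hfin Hx'; destruct (classic (a ∈ x)) as [Ha | Ha].
  { replace x' with x; [exact Hfin|].
    apply set_ext; intro z; rewrite (Hx' z); split; [auto|].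
    intros [H | ->]; auto. }
  destruct Hfin as [n [f [Hn [Hf Hbij]]]].
  (* The bijection from [n] is extended to [n + 1] by sending the new argument [n] to [a]. *)
  destruct (succ_exists n) as [m Hm], (opair_exists n a) as [p Hp].
  destruct (adjoin_exists f p) as [f' Hf'].
  destruct (function_adjoin Hf (mem_irrefl (x := n)) Hm (B' := x') (b := a)
    (p := p) (f' := f')) as [Hfun Hrel]; auto.
  { intros z Hz; apply Hx'; auto. }
  { apply Hx'; auto. }
  exists m, f'; split; [exact (succ_natural Hn Hm)|]; split; [exact Hfun|].
  intros y Hy; apply Hx' in Hy as [Hy | ->].
  - destruct (Hbij y Hy) as [i [Hi Hu]]; exists i; split; [apply Hrel; auto|].
    intros j Hj; apply Hrel in Hj as [Hj | [_ ->]]; [auto|contradiction].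
  - exists n; split; [apply Hrel; auto|].
    intros j Hj; apply Hrel in Hj as [Hj | [-> _]]; [|reflexivity].
    elim Ha; exact (proj2 (function_dom Hf Hj)).
Qed.

(** For a bijection [f] from [n] to [x], induction on [k] shows that the image of each [k] contained
    in [n] belongs to [C]; the image of [n] is [x]. Only elements [a] of [x] are ever adjoined, so
    [C] can be a set of subsets of [x], as in [finite_ind]. *)
Lemma finite_set_ind x C :
  finite x ->
  (forall o, is_empty o -> o ∈ C) ->
  (forall z a z', z ∈ C -> a ∈ x -> adjoin z' z a -> z' ∈ C) ->
  x ∈ C.
Proof.
  intros [n [f [Hn [Hf Hbij]]]] H0 HS.
  assert (Himg : forall k, is_natural k -> subset k n -> exists X, X ∈ C /\
    forall y, y ∈ X <-> exists i, i ∈ k /\ related f i y).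
  { apply (@natural_ind (fun k n f C => subset k n -> exists X, X ∈ C /\
      forall y, y ∈ X <-> exists i, i ∈ k /\ related f i y)
      ltac:(definability) n f C).
    - intros o Ho _; exists o; split; [auto|].
      intro y; split; [intro Hy; elim (Ho y Hy)|].
      intros [i [Hi _]]; elim (Ho i Hi).
    - intros k k' _ Hk' IH Hsub.
      destruct IH as [X [HX HXk]].
      { intros i Hi; apply Hsub, Hk'; auto. }
      assert (Hk : k ∈ n) by (apply Hsub, Hk'; auto).
      destruct (function_value Hf Hk) as [v Hv].
      destruct (adjoin_exists X v) as [X' HX'].
      exists X'; split.
      + apply (HS X v X' HX); [exact (proj2 (function_dom Hf Hv))|exact HX'].
      + intro y; rewrite (HX' y), (HXk y); split.
        * intros [[i [Hi Hy]] | ->]; [exists i | exists k];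
            split; auto; apply Hk'; auto.
        * intros [i [Hi Hy]]; apply Hk' in Hi as [Hi | ->]; [left; eauto|].
          right; exact (function_unique Hf Hy Hv). }
  destruct (Himg n Hn) as [X [HX HXn]]; [intros z Hz; exact Hz|].
  replace x with X; [exact HX|].
  apply set_ext; intro y; rewrite (HXn y); split.
  - intros [i [_ Hy]]; exact (proj2 (function_dom Hf Hy)).
  - intro Hy; destruct (Hbij y Hy) as [i [Hi _]]; exists i; split; [|exact Hi].
    exact (proj1 (function_dom Hf Hi)).
Qed.

Lemma finite_ind (P : M -> M -> M -> M -> Prop)
    (dP : definable (fun e => P (e 0) (e 1) (e 2) (e 3))) p q r :
  (forall o, is_empty o -> P o p q r) ->
  (forall z a z', adjoin z' z a -> P z p q r -> P z' p q r) ->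
  forall x, finite x -> P x p q r.
Proof.
  intros H0 HS x Hx; destruct (ZF_power Z x) as [W HW].
  destruct (@separation P dP p q r W) as [C HC].
  apply (HC x), (finite_set_ind Hx).
  - intros o Ho; apply HC; split; [|auto].
    apply HW; intros z Hz; elim (Ho z Hz).
  - intros z a z' Hz Ha Hz'; apply HC in Hz as [Hz HPz]; apply HW in Hz.
    apply HC; split; [|eauto].
    apply HW; intros y Hy; apply Hz' in Hy as [Hy | ->]; auto.
Qed.

(** Induction on [x]. When [a] is adjoined and some member of [F] contains [a], the induction
    hypothesis is applied to the family of subsets [u] of [x] with [u ∪ {a}] in [F]; a maximal [u]
    there gives the maximal member [u ∪ {a}] of [F], because every larger member also contains [a].
    If no member contains [a], then [F] already consists of subsets of [x]. *)
Lemma finite_maximal_member x :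
  finite x ->
  forall F, (exists z, z ∈ F) -> (forall z, z ∈ F -> subset z x) ->
  exists z, z ∈ F /\ forall u, u ∈ F -> subset z u -> u = z.
Proof.
  intro Hx.
  apply (@finite_ind (fun x _ _ _ =>
    forall F, (exists z, z ∈ F) -> (forall z, z ∈ F -> subset z x) ->
    exists z, z ∈ F /\ forall u, u ∈ F -> subset z u -> u = z)
    ltac:(definability) x x x); [| |exact Hx].
  - intros o Ho F [z Hz] HF; exists z; split; [exact Hz|].
    intros u Hu _; apply empty_unique; intros y Hy.
    + exact (Ho y (HF u Hu y Hy)).
    + exact (Ho y (HF z Hz y Hy)).
  - clear x Hx; intros x a x' Hx' IH F Hne HF.
    destruct (classic (exists z, z ∈ F /\ a ∈ z)) as [[z1 [Hz1 Ha1]] | Hno].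
    + destruct (ZF_power Z x) as [W HW].
      destruct (@separation (fun u F a _ => exists v, v ∈ F /\
          forall y, y ∈ v <-> y ∈ u \/ y = a) ltac:(definability) F a a W)
        as [F1 HF1].
      (* Each member of [F] containing [a] is recovered from its trace on [x], so that trace belongs
         to [F1]. *)
      assert (Hcut : forall z, z ∈ F -> a ∈ z -> exists u, u ∈ F1 /\
        forall y, y ∈ u <-> y ∈ x /\ y ∈ z).
      { intros z Hz Haz.
        destruct (@separation (fun y z _ _ => y ∈ z) ltac:(definability) z z z x)
          as [u Hu].
        exists u; split; [|exact Hu].
        apply HF1; split; [apply HW; intros y Hy; apply Hu, Hy|].
        exists z; split; [exact Hz|].
        intro y; rewrite (Hu y); split.
        - intro Hy; destruct (proj1 (Hx' y) (HF z Hz y Hy)); auto.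
        - intros [[_ Hy] | ->]; auto. }
      destruct (IH F1) as [u0 [Hu0 Hmax]].
      { destruct (Hcut z1 Hz1 Ha1) as [u [Hu _]]; eauto. }
      { intros u Hu; apply HW, (HF1 u), Hu. }
      apply HF1 in Hu0 as [Hu0W [z0 [Hz0 Hzu]]]; apply HW in Hu0W.
      exists z0; split; [exact Hz0|].
      intros v Hv Hsub.
      assert (Hav : a ∈ v) by (apply Hsub, Hzu; auto).
      destruct (Hcut v Hv Hav) as [u [Hu Huv]].
      assert (u = u0) as ->.
      { apply Hmax; [exact Hu|].
        intros y Hy; apply Huv; split; [auto|apply Hsub, Hzu; auto]. }
      apply set_ext; intro y; rewrite (Hzu y), (Huv y); split.
      * intro Hy; destruct (proj1 (Hx' y) (HF v Hv y Hy)); auto.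
      * intros [[_ Hy] | ->]; auto.
    + apply IH; [exact Hne|].
      intros z Hz y Hy; destruct (proj1 (Hx' y) (HF z Hz y Hy)) as [Hyx | ->];
        [exact Hyx|elim Hno; eauto].
Qed.

(** * Chains under inclusion *)

Definition chain Y : Prop :=
  forall s t, s ∈ Y -> t ∈ Y -> subset s t \/ subset t s.

Lemma finite_chain_top Y :
  finite Y -> chain Y -> (exists s, s ∈ Y) ->
  exists t, t ∈ Y /\ forall s, s ∈ Y -> subset s t.
Proof.
  intro HY.
  apply (@finite_ind (fun Y _ _ _ => chain Y -> (exists s, s ∈ Y) ->
    exists t, t ∈ Y /\ forall s, s ∈ Y -> subset s t)
    ltac:(unfold chain; definability) Y Y Y); [| |exact HY].
  - intros o Ho _ [s Hs]; elim (Ho s Hs).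
  - intros z a z' Hz' IH Hch _.
    assert (Ha : a ∈ z') by (apply Hz'; auto).
    destruct (classic (exists s, s ∈ z)) as [Hne | Hempty].
    + destruct IH as [t [Ht Htop]]; [|exact Hne|].
      { intros s t Hs Ht; apply Hch; apply Hz'; auto. }
      assert (Ht' : t ∈ z') by (apply Hz'; auto).
      destruct (Hch t a Ht' Ha) as [H | H].
      * exists a; split; [exact Ha|].
        intros s Hs; apply Hz' in Hs as [Hs | ->]; intros y Hy; auto.
        apply H, (Htop s Hs), Hy.
      * exists t; split; [exact Ht'|].
        intros s Hs; apply Hz' in Hs as [Hs | ->]; auto.
    + exists a; split; [exact Ha|].
      intros s Hs; apply Hz' in Hs as [Hs | ->]; [elim Hempty; eauto|].
      intros y Hy; exact Hy.
Qed.

(** * From dependent choice to colorings *)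

Lemma sequence_monotone s w S :
  is_omega w -> is_function s w S ->
  (forall n m x y, n ∈ w -> is_succ m n ->
     related s n x -> related s m y -> subset x y) ->
  forall m n x y, is_natural m -> n ∈ m ->
    related s n x -> related s m y -> subset x y.
Proof.
  intros Hw Hs Hstep m n x y Hm; revert n x y.
  apply (@natural_ind (fun m s _ _ => forall n x y, n ∈ m ->
    related s n x -> related s m y -> subset x y)
    ltac:(definability) s s s); [| |exact Hm].
  - intros o Ho n x y Hn; elim (Ho n Hn).
  - intros k k' Hk Hk' IH n x y Hn Hx Hy; apply Hw in Hk as Hkw.
    destruct (function_value Hs Hkw) as [v Hv].
    assert (Hvy : subset v y) by exact (Hstep k k' v y Hkw Hk' Hv Hy).
    apply Hk' in Hn as [Hn | ->].
    + intros z Hz; exact (Hvy z (IH n x v Hn Hx Hv z Hz)).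
    + rewrite (function_unique Hs Hx Hv); exact Hvy.
Qed.

Lemma DC_coloring : DC M -> coloring_statement M.
Proof.
  intros HDC V E _ _ f _ Hfin; apply NNPP; intro Hnomax.
  destruct (ZF_power Z V) as [W HW].
  destruct (@separation (fun Y V f _ => monochromatic0 V f Y)
    ltac:(definability) V f f W) as [S HS].
  assert (HSm : forall Y, Y ∈ S <-> monochromatic0 V f Y).
  { intro Y; rewrite HS, (HW Y); split; [tauto|].
    intro H; split; [exact (proj1 H)|exact H]. }
  (* DC is applied to proper inclusion on the set [S] of all 0-monochromatic sets. It is non-empty
     because of the empty set, and [R] is total because no member is maximal. *)
  destruct (@relation_comprehension (fun x y _ => proper_subset x y)
    ltac:(definability) V S S) as [R [HRS HR]].
  destruct (HDC S R) as [w [s [Hw [Hs Hstep]]]]; [|exact HRS| |].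
  - destruct empty_exists as [o Ho]; exists o; apply HSm; split.
    + intros z Hz; elim (Ho z Hz).
    + intros e [x [y [Hx _]]]; elim (Ho x Hx).
  - intros Y HY; apply NNPP; intro Hno; apply Hnomax; exists Y.
    apply HSm in HY as HYm; split; [exact HYm|].
    intros [Y' [HY' Hsub]]; apply HSm in HY'.
    apply Hno; exists Y'; split; [|apply HR]; auto.
  - assert (Hmono : forall m n x y, is_natural m -> n ∈ m ->
      related s n x -> related s m y -> subset x y).
    { apply (sequence_monotone Hw Hs); intros n m x y Hn Hm Hx Hy.
      apply (HR x y), (Hstep n m x y Hn Hm Hx Hy). }
    (* [T] is the range of the sequence. *)
    destruct (@separation (fun y s _ _ => exists n, related s n y)
      ltac:(definability) s s s S) as [T HT].
    assert (HTs : forall n x, related s n x -> x ∈ T).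
    { intros n x Hx; apply HT; split; [exact (proj2 (function_dom Hs Hx))|eauto]. }
    assert (Hchain : chain T).
    { intros Y1 Y2 H1 H2; apply HT in H1 as [_ [n1 H1]], H2 as [_ [n2 H2]].
      assert (Hn1 := proj1 (Hw n1) (proj1 (function_dom Hs H1))).
      assert (Hn2 := proj1 (Hw n2) (proj1 (function_dom Hs H2))).
      destruct (natural_trichotomy Hn1 Hn2) as [H | [<- | H]].
      - left; exact (Hmono n2 n1 Y1 Y2 Hn2 H H1 H2).
      - rewrite (function_unique Hs H1 H2); left; intros z Hz; exact Hz.
      - right; exact (Hmono n1 n2 Y2 Y1 Hn1 H H2 H1). }
    destruct (ZF_union Z T) as [U HU].
    assert (HUm : monochromatic0 V f U).
    { split.
      - intros z Hz; apply HU in Hz as [Y [HY Hz]]; apply HT in HY as [HY _].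
        apply (HSm Y); auto.
      - intros e [x [y [Hx [Hy [Hxy He]]]]].
        apply HU in Hx as [Y1 [H1 Hx]], Hy as [Y2 [H2 Hy]].
        (* Since [T] is a chain, both ends of the pair lie in a single member, which is
           0-monochromatic. *)
        assert (HY : exists Y, Y ∈ T /\ x ∈ Y /\ y ∈ Y).
        { destruct (Hchain Y1 Y2 H1 H2) as [H | H]; [exists Y2 | exists Y1]; auto. }
        destruct HY as [Y [HY [HxY HyY]]]; apply HT in HY as [HY _].
        apply HSm in HY as [_ HY]; apply HY; exists x, y; auto. }
    destruct (finite_maximal_member (Hfin U HUm) (F := T)) as [Y [HY Hmax]].
    + destruct empty_exists as [o Ho].
      destruct (function_value Hs (proj2 (Hw o) (zero_natural Ho))) as [y Hy]; eauto.
    + intros Y HY z Hz; apply HU; eauto.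
    (* The maximal member is the term with index [n], but the next term properly contains it. *)
    + apply HT in HY as [_ [n Hn]].
      assert (Hnw := proj1 (function_dom Hs Hn)).
      destruct (succ_exists n) as [m Hm].
      assert (Hmw : m ∈ w) by exact (proj2 (Hw m) (succ_natural (proj1 (Hw n) Hnw) Hm)).
      destruct (function_value Hs Hmw) as [Y' HY'].
      assert (Hlt := Hstep n m Y Y' Hnw Hm Hn HY').
      apply HR in Hlt as [_ [_ [Hsub Hneq]]].
      apply Hneq; symmetry; apply Hmax; eauto.
Qed.

(** * From colorings to independent sets *)

Lemma maximal_ext (P Q : M -> Prop) Y :
  (forall X, P X <-> Q X) -> maximal P Y -> maximal Q Y.
Proof.
  intros HPQ [HY Hmax]; split; [apply HPQ, HY|].
  intros [X [HX Hsub]]; apply Hmax; exists X; split; [apply HPQ, HX|exact Hsub].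
Qed.

(** The coloring is the characteristic function of [E] on $[V]^2$, so color $0$ means that the pair
    is not an edge. *)
Lemma edge_coloring V E : is_graph V E ->
  exists f, is_coloring f V /\
    forall Y, monochromatic0 V f Y <-> independent V E Y.
Proof.
  intro HG.
  destruct empty_exists as [o Ho], (succ_exists o) as [i Hi].
  assert (Hoi : o <> i).
  { intro H; apply (Ho o); rewrite H at 2; apply Hi; auto. }
  destruct (ZF_pairing Z o i) as [t Ht], (ZF_power Z V) as [W HW].
  destruct (@separation (fun e V _ _ => two_subset e V)
    ltac:(definability) V V V W) as [P HP0].
  assert (HP : is_two_subsets P V).
  { intro e; rewrite HP0; split; [tauto|]; intro He; split; [|exact He].
    apply HW; destruct He as [x [y [Hx [Hy [_ He]]]]].
    intros z Hz; apply He in Hz as [-> | ->]; auto. }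
  destruct (@relation_comprehension
    (fun e v E => e ∈ E /\ is_one v \/ ~ e ∈ E /\ is_empty v)
    ltac:(definability) E P t) as [f [Hft Hf]].
  assert (Hi1 : is_one i) by (exists o; auto).
  assert (Hone : forall v, is_one v -> v = i).
  { intros v [o' [Ho' Hv]]; rewrite (empty_unique Ho' Ho) in Hv.
    exact (succ_unique Hv Hi). }
  assert (Hf0 : forall e, e ∈ P -> (related f e o <-> ~ e ∈ E)).
  { intros e He; rewrite (Hf e o); split.
    - intros [_ [_ [[_ H] | [H _]]]]; [elim Hoi; auto|exact H].
    - intro H; repeat split; auto; apply Ht; auto. }
  exists f; split.
  - exists P, t; split; [exact HP|]; split; [exists o, i; auto|].
    split; [exact Hft|].
    intros e He; destruct (classic (e ∈ E)) as [HeE | HeE].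
    + exists i; split.
      * apply Hf; repeat split; auto; apply Ht; auto.
      * intros v Hv; apply Hf in Hv as [_ [_ [[_ Hv] | [Hv _]]]];
          [symmetry; auto|contradiction].
    + exists o; split; [apply Hf0; auto|].
      intros v Hv; apply Hf in Hv as [_ [_ [[Hv _] | [_ Hv]]]];
        [contradiction|exact (empty_unique Ho Hv)].
  - intro Y; split; intros [HYV HY]; split; try exact HYV.
    + intros x y Hx Hy Hxy [e [He HeE]].
      destruct (HY e) as [o' [Ho' He']]; [exists x, y; auto|].
      rewrite (empty_unique Ho' Ho) in He'.
      apply Hf0 in He'; [contradiction|apply HP, HG, HeE].
    + intros e [x [y [Hx [Hy [Hxy He]]]]]; exists o; split; [exact Ho|].
      apply Hf0.
      * apply HP; exists x, y; auto.
      * intro HeE; apply (HY x y Hx Hy Hxy); exists e; auto.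
Qed.

Lemma coloring_independent_set :
  coloring_statement M -> independent_set_statement M.
Proof.
  intros Hcol V E HG Hinf Hfin.
  destruct (edge_coloring HG) as [f [Hf Hmono]].
  destruct (Hcol V E HG Hinf f Hf) as [Y HY].
  - intros Y HY; apply Hfin, Hmono, HY.
  - exists Y; exact (maximal_ext Hmono HY).
Qed.

(** * Finite paths of a relation *)

(** The length [n] is the domain of [s]. A path may start anywhere in [S], and the empty set is a
    path of length $0$. *)
Definition path S R s n : Prop :=
  is_natural n /\ is_function s n S /\
  forall k m x y, is_succ m k -> m ∈ n ->
    related s k x -> related s m y -> related R x y.

Lemma paths_exist S R :
  exists V, forall s, s ∈ V <-> exists n, path S R s n.
Proof.
  (* Natural numbers have natural members, so every path is a subset of the product of omega and
     [S]. *)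
  destruct omega_exists as [w Hw], (product_exists w S) as [C HC].
  destruct (ZF_power Z C) as [W HW].
  destruct (@separation (fun s S R _ => exists n, path S R s n)
    ltac:(unfold path; definability) S R R W) as [V HV].
  exists V; intro s; rewrite HV; split; [tauto|].
  intros [n Hn]; split; [|eauto].
  apply HW; intros p Hp; apply HC; destruct Hn as [Hn [[Hs _] _]].
  destruct (Hs p Hp) as [x [y [Hx [Hy Hpxy]]]]; exists x, y; repeat split; auto.
  apply Hw, (mem_natural Hn Hx).
Qed.

Lemma path_extend S R s n :
  (exists x, x ∈ S) ->
  (forall x, x ∈ S -> exists y, y ∈ S /\ related R x y) ->
  path S R s n -> exists s' n', path S R s' n' /\ subset s s' /\ ~ subset s' s.
Proof.
  intros [x0 Hx0] Htot [Hn [Hs HR]].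
  (* The value [y] for the new index [n] is an [R]-successor of the last entry if there is one, and
     [x0] otherwise. Only one element is picked, so no choice principle enters. *)
  assert (Hy : exists y, y ∈ S /\
    forall k x, is_succ n k -> related s k x -> related R x y).
  { destruct (classic (exists k x, is_succ n k /\ related s k x))
      as [[k [x [Hk Hx]]] | Hno].
    - destruct (Htot x (proj2 (function_dom Hs Hx))) as [y [Hy Hxy]].
      exists y; split; [exact Hy|].
      intros k' x' Hk' Hx'.
      assert (k' = k) as ->.
      (* Both [k] and [k'] have successor [n], so each is contained in the other. *)
      { assert (Hk'n : k' ∈ n) by (apply Hk'; auto).
        assert (Hkn : k ∈ n) by (apply Hk; auto).
        pose proof (mem_succ_subset (mem_natural Hn Hkn) Hk Hk'n) as H1.
        pose proof (mem_succ_subset (mem_natural Hn Hk'n) Hk' Hkn) as H2.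
        apply set_ext; intro z; split; auto. }
      rewrite (function_unique Hs Hx' Hx); exact Hxy.
    - exists x0; split; [exact Hx0|].
      intros k x Hk Hx; elim Hno; eauto. }
  destruct Hy as [y [Hy HRy]].
  destruct (succ_exists n) as [n' Hn'], (opair_exists n y) as [p Hp].
  destruct (adjoin_exists s p) as [s' Hs'].
  destruct (function_adjoin Hs (mem_irrefl (x := n)) Hn' (B' := S)
    (fun z Hz => Hz) Hy Hp Hs') as [Hfun Hrel].
  exists s', n'; split; [split; [exact (succ_natural Hn Hn')|split]|split].
  - exact Hfun.
  - intros k m x v Hm Hmn' Hx Hv; apply Hrel in Hx as [Hx | [-> ->]].
    + apply Hrel in Hv as [Hv | [-> ->]]; [|eauto].
      exact (HR k m x v Hm (proj1 (function_dom Hs Hv)) Hx Hv).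
    (* The new index [n] cannot be followed by another one: [m ∈ n + 1] gives that [m] is a subset
       of [n], and [n ∈ m] would then give [n ∈ n]. *)
    + assert (Hnm : n ∈ m) by (apply Hm; auto).
      elim (mem_irrefl (mem_succ_subset Hn Hn' Hmn' Hnm)).
  - intros z Hz; apply Hs'; auto.
  - intro Hsub; apply (mem_irrefl (x := n)).
    apply (function_dom (y := y) Hs).
    apply (related_opair s Hp), Hsub, Hs'; auto.
Qed.

Lemma path_eq S R s t n :
  path S R s n -> path S R t n -> subset s t \/ subset t s -> s = t.
Proof.
  intros [_ [Hs _]] [_ [Ht _]] [H | H]; [|symmetry]; eapply function_subset_eq; eauto.
Qed.

(** This is the form needed to pass from the paths of length at most [k] in a chain to those of
    length at most [k + 1]. *)
Lemma finite_one_more X X' :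
  finite X -> subset X X' ->
  (forall s t, s ∈ X' -> t ∈ X' -> ~ s ∈ X -> ~ t ∈ X -> s = t) -> finite X'.
Proof.
  intros HX Hsub Hone.
  destruct (classic (exists a, a ∈ X' /\ ~ a ∈ X)) as [[a [Ha HaX]] | Hno].
  - apply (finite_adjoin (a := a) HX); intro z; split.
    + intro Hz; destruct (classic (z ∈ X)); auto.
    + intros [Hz | ->]; auto.
  - replace X' with X; [exact HX|].
    apply set_ext; intro z; split; [apply Hsub|].
    intro Hz; apply NNPP; intro HzX; apply Hno; eauto.
Qed.

(* By induction on [k], only finitely many paths in [Y] have length at most [k]:
   a chain contains at most one path of each length. *)
Lemma bounded_path_chain_finite S R Y n :
  (forall s, s ∈ Y -> exists m, path S R s m) -> chain Y -> is_natural n ->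
  (forall s m, s ∈ Y -> path S R s m -> ~ n ∈ m) -> finite Y.
Proof.
  intros HY Hch Hn Hbound.
  (* For natural numbers, [~ k ∈ m] expresses that the length [m] is at most [k]. *)
  assert (Hex : forall k, exists X, forall s, s ∈ X <->
    s ∈ Y /\ exists m, path S R s m /\ ~ k ∈ m).
  { intro k; apply (@separation (fun s S R k => exists m, path S R s m /\ ~ k ∈ m)
      ltac:(unfold path; definability)). }
  assert (H : exists X, finite X /\ forall s, s ∈ X <->
    s ∈ Y /\ exists m, path S R s m /\ ~ n ∈ m).
  { apply (@natural_ind (fun k Y S R => exists X, finite X /\ forall s, s ∈ X <->
      s ∈ Y /\ exists m, path S R s m /\ ~ k ∈ m)
      ltac:(unfold path; definability) Y S R); [| |exact Hn].
    - intros o Ho; destruct (Hex o) as [X HX]; exists X; split; [|exact HX].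
      apply (finite_one_more (finite_empty Ho)).
      { intros z Hz; elim (Ho z Hz). }
      intros s t Hs Ht _ _.
      apply HX in Hs as [Hs [m [Hsm Hom]]], Ht as [Ht [m' [Htm' Hom']]].
      destruct (zero_or_mem (proj1 Hsm) Ho) as [<- |]; [|contradiction].
      destruct (zero_or_mem (proj1 Htm') Ho) as [<- |]; [|contradiction].
      exact (path_eq Hsm Htm' (Hch s t Hs Ht)).
    - intros k k' Hk Hk' [X [HXfin HX]].
      destruct (Hex k') as [X' HX']; exists X'; split; [|exact HX'].
      assert (Hlen : forall s, s ∈ X' -> ~ s ∈ X -> path S R s k').
      { intros s Hs HsX; apply HX' in Hs as [HsY [m [Hm Hk'm]]].
        assert (Hkm : k ∈ m).
        { apply NNPP; intro Hkm; apply HsX, HX; eauto. }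
        destruct (succ_mem_or_eq (proj1 Hm) Hkm Hk') as [-> |];
          [exact Hm|contradiction]. }
      apply (finite_one_more HXfin).
      + intros s Hs; apply HX in Hs as [HsY [m [Hm Hkm]]].
        apply HX'; split; [exact HsY|]; exists m; split; [exact Hm|].
        intro Hk'm; apply Hkm, (natural_transitive (proj1 Hm) Hk'm), Hk'; auto.
      + intros s t Hs Ht HsX HtX; apply (path_eq (Hlen s Hs HsX) (Hlen t Ht HtX)).
        apply Hch; [apply (HX' s), Hs | apply (HX' t), Ht]. }
  destruct H as [X [HX HXY]]; replace Y with X; [exact HX|].
  apply set_ext; intro s; rewrite (HXY s); split; [tauto|].
  intro Hs; split; [exact Hs|].
  destruct (HY s Hs) as [m Hm]; eauto.
Qed.

Lemma infinite_path_chain_sequence S R Y :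
  (forall s, s ∈ Y -> exists n, path S R s n) -> chain Y -> infinite Y ->
  exists w s, is_omega w /\ is_function s w S /\
    forall n m x y, n ∈ w -> is_succ m n ->
      related s n x -> related s m y -> related R x y.
Proof.
  intros HY Hch Hinf.
  destruct omega_exists as [w Hw], (ZF_union Z Y) as [U HU].
  assert (HUr : forall x y, related U x y <-> exists s, s ∈ Y /\ related s x y).
  { intros x y; destruct (opair_exists x y) as [p Hp].
    rewrite (related_opair U Hp), (HU p); split; intros [s [Hs H]];
      exists s; split; auto; apply (related_opair s Hp); auto. }
  (* Any two values of [U] come from one path of the chain, so uniqueness of values and the
     [R]-steps are inherited from that path. *)
  assert (Hcommon : forall x y x' y', related U x y -> related U x' y' ->
    exists s, s ∈ Y /\ related s x y /\ related s x' y').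
  { intros x y x' y' H H'.
    apply HUr in H as [s [Hs H]], H' as [s' [Hs' H']].
    destruct (Hch s s' Hs Hs') as [Hsub | Hsub]; [exists s' | exists s];
      repeat split; auto; exact (related_subset Hsub ltac:(eassumption)). }
  exists w, U; split; [exact Hw|]; split; [split|].
  - intros p Hp; apply HU in Hp as [s [Hs Hp]].
    destruct (HY s Hs) as [n [Hn [[Hrel _] _]]].
    destruct (Hrel p Hp) as [x [y [Hx [Hy Hpxy]]]].
    exists x, y; repeat split; auto; apply Hw, (mem_natural Hn Hx).
  - intros n Hn; apply Hw in Hn.
    assert (Hv : exists y, related U n y).
    (* If [U] had no value at [n], no path in [Y] would have [n] in its domain, and the bound on
       lengths would make [Y] finite. *)
    { apply NNPP; intro Hno; apply Hinf.
      apply (bounded_path_chain_finite HY Hch Hn).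
      intros s m Hs [_ [Hm _]] Hnm; destruct (function_value Hm Hnm) as [y Hy].
      apply Hno; exists y; apply HUr; eauto. }
    destruct Hv as [y Hy]; exists y; split; [exact Hy|].
    intros y' Hy'; destruct (Hcommon n y n y' Hy Hy') as [s [Hs [H H']]].
    destruct (HY s Hs) as [m [_ [Hm _]]]; exact (function_unique Hm H H').
  - intros n m x y _ Hm Hx Hy.
    destruct (Hcommon n x m y Hx Hy) as [s [Hs [H H']]].
    destruct (HY s Hs) as [k [_ [Hk HR]]].
    exact (HR n m x y Hm (proj1 (function_dom Hk H')) H H').
Qed.

(** * From independent sets to dependent choice *)

Lemma incomparability_graph V :
  exists E, is_graph V E /\
    forall Y, independent V E Y <-> subset Y V /\ chain Y.
Proof.
  destruct (ZF_power Z V) as [W HW].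
  destruct (@separation (fun e V _ _ => exists s t, s ∈ V /\ t ∈ V /\
      ~ (subset s t \/ subset t s) /\ is_pair e s t)
    ltac:(definability) V V V W) as [E HE].
  exists E; split.
  - intros e He; apply HE in He as [_ [s [t [Hs [Ht [Hst He]]]]]].
    exists s, t; repeat split; auto; [|apply He|apply He].
    intros ->; apply Hst; left; intros z Hz; exact Hz.
  - intro Y; split; intros [HYV HY]; split; try exact HYV.
    + intros s t Hs Ht; apply NNPP; intro Hst.
      destruct (ZF_pairing Z s t) as [e He].
      apply (HY s t Hs Ht).
      * intros ->; apply Hst; left; intros z Hz; exact Hz.
      * exists e; split; [exact He|]; apply HE; split.
        -- apply HW; intros z Hz; apply He in Hz as [-> | ->]; auto.
        -- exists s, t; auto.
    + intros s t Hs Ht _ [e [He HeE]].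
      apply HE in HeE as [_ [s' [t' [_ [_ [Hst He']]]]]]; apply Hst.
      destruct (is_pair_inj He He') as [[<- <-] | [<- <-]]; auto.
Qed.

(* If [V] is finite, the graph statement says nothing, and the finiteness of [V]
   gives the maximal set directly. *)
Lemma independent_set_statement_all V E :
  independent_set_statement M -> is_graph V E ->
  (forall Y, independent V E Y -> finite Y) ->
  exists Y, maximal (independent V E) Y.
Proof.
  intros Hind HG Hfin; destruct (classic (finite V)) as [HV | HV];
    [|exact (Hind V E HG HV Hfin)].
  destruct (ZF_power Z V) as [W HW].
  destruct (@separation (fun Y V E _ => independent V E Y)
    ltac:(definability) V E E W) as [F HF].
  destruct (finite_maximal_member HV (F := F)) as [Y [HY Hmax]].
  - destruct empty_exists as [o Ho]; exists o; apply HF.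
    assert (Hsub : subset o V) by (intros z Hz; elim (Ho z Hz)).
    split; [apply HW, Hsub|split; [exact Hsub|]].
    intros x y Hx; elim (Ho x Hx).
  - intros Y HY; apply HW, HF, HY.
  - exists Y; split; [apply (HF Y), HY|].
    intros [X [HX [Hsub Hneq]]]; apply Hneq; symmetry; apply Hmax; [|exact Hsub].
    apply HF; split; [apply HW, (proj1 HX)|exact HX].
Qed.

Lemma independent_set_DC : independent_set_statement M -> DC M.
Proof.
  intros Hind S R Hne _ Htot; apply NNPP; intro Hno.
  destruct (paths_exist S R) as [V HV], (incomparability_graph V) as [E [HG HE]].
  (* An infinite independent set would yield the sequence that [Hno] excludes. *)
  assert (Hfin : forall Y, independent V E Y -> finite Y).
  { intros Y HY; apply HE in HY as [HYV Hch]; apply NNPP; intro Hinf; apply Hno.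
    apply (infinite_path_chain_sequence (Y := Y)); auto.
    intros s Hs; apply HV; auto. }
  destruct (independent_set_statement_all Hind HG Hfin) as [Y [HY Hmax]].
  assert (HYfin := Hfin Y HY); apply HE in HY as [HYV Hch].
  (* A path outside [Y] that extends all members of [Y] can be added to the chain, against
     maximality. *)
  assert (Hnew : exists t, t ∈ V /\ ~ t ∈ Y /\ forall s, s ∈ Y -> subset s t).
  { destruct (classic (exists s, s ∈ Y)) as [HYne | Hempty].
    - destruct (finite_chain_top HYfin Hch HYne) as [t [Ht Htop]].
      destruct (proj1 (HV t) (HYV t Ht)) as [n Hn].
      (* The prolonged path is not in [Y], since it is not contained in the top member [t]. *)
      destruct (path_extend Hne Htot Hn) as [t' [n' [Hn' [Hsub Hnsub]]]].
      exists t'; split; [apply HV; eauto|]; split.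
      + intro Ht'; exact (Hnsub (Htop t' Ht')).
      + intros s Hs z Hz; apply Hsub, (Htop s Hs), Hz.
    (* For empty [Y] the path of length $0$ is added. *)
    - destruct empty_exists as [o Ho]; exists o; split; [|split].
      + apply HV; exists o; split; [exact (zero_natural Ho)|].
        split; [split|]; try (intros z Hz; elim (Ho z Hz)).
        intros k m x y _ Hm; elim (Ho m Hm).
      + intro HoY; apply Hempty; eauto.
      + intros s Hs; elim Hempty; eauto. }
  destruct Hnew as [t [HtV [HtY Htop]]], (adjoin_exists Y t) as [Y' HY'].
  apply Hmax; exists Y'; split; [apply HE; split|split].
  - intros s Hs; apply HY' in Hs as [Hs | ->]; auto.
  - intros s s' Hs Hs'; apply HY' in Hs as [Hs | ->], Hs' as [Hs' | ->]; auto.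
    left; intros z Hz; exact Hz.
  - intros s Hs; apply HY'; auto.
  - intros ->; apply HtY, HY'; auto.
Qed.

End Sets.

Theorem theorem3p6 : forall M : set_structure, ZF M ->
  (DC M <-> coloring_statement M) /\
  (coloring_statement M <-> independent_set_statement M) /\
  (DC M <-> independent_set_statement M).
Proof.
  intros M Z.
  pose proof (DC_coloring Z).
  pose proof (coloring_independent_set Z).
  pose proof (independent_set_DC Z).
  tauto.
Qed.
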